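(* Let $p>1$, $R,T>0$, and let $u\in C^{2,1}(Q_{R,T})$ be a classical solution of $u_t-\Delta u=|\nabla u|^p$ in $Q_{R,T}:=B_R\times(0,T)$ such that $M:=\sup_{Q_{R,T}}u<\infty$. Then there is $C=C(n,p)>0$ such that $$|\nabla u(x,t)|\le C\left\{\frac{M-u(x,t)}{R}+\Big(\frac{M-u(x,t)}{\min(R^2,t)}\Big)^{1/p}\right\}\quad\text{for all }(x,t)\in B_{R/2}\times(0,T).$$
   Context: $B_R:=\{x\in\mathbb{R}^n: |x|<R\}$. *)

(* Defs.v *)
From HB Require Import structures.
From mathcomp Require Import all_boot all_order all_algebra.
From mathcomp Require Import all_classical all_reals all_analysis.
Set Implicit Arguments. Unset Strict Implicit. Unset Printing Implicit Defensive.
Import Order.TTheory GRing.Theory Num.Theory.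
Import numFieldNormedType.Exports.
Local Open Scope ring_scope.
Local Open Scope classical_set_scope.

Section Defs.
Variables (R : realType) (n : nat).

Definition ev (i : 'I_n) : 'rV[R]_n := delta_mx 0 i.

Definition enorm (x : 'rV[R]_n) : R := Num.sqrt (\sum_(i < n) x 0 i ^+ 2).

Definition cyl (Rr T : R) : set ('rV[R]_n * R) :=
  [set z | enorm z.1 < Rr /\ 0 < z.2 < T].

Definition dx (i : 'I_n) (u : 'rV[R]_n -> R -> R) (x : 'rV[R]_n) (t : R) : R :=
  'D_(ev i) (fun y => u y t) x.

Definition dt (u : 'rV[R]_n -> R -> R) (x : 'rV[R]_n) (t : R) : R :=
  'D_1 (u x) t.

Definition gradnorm (u : 'rV[R]_n -> R -> R) x t : R :=
  Num.sqrt (\sum_(i < n) (dx i u x t) ^+ 2).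

Definition lap (u : 'rV[R]_n -> R -> R) x t : R :=
  \sum_(i < n) dx i (dx i u) x t.

Definition C21 (Q : set ('rV[R]_n * R)) (u : 'rV[R]_n -> R -> R) : Prop :=
  {in Q, continuous (fun z => u z.1 z.2)} /\
  (forall i, forall z, Q z -> derivable (fun y => u y z.2) z.1 (ev i)) /\
  (forall i, {in Q, continuous (fun z => dx i u z.1 z.2)}) /\
  (forall i j, forall z, Q z -> derivable (fun y => dx i u y z.2) z.1 (ev j)) /\
  (forall i j, {in Q, continuous (fun z => dx j (dx i u) z.1 z.2)}) /\
  (forall z, Q z -> derivable (u z.1) z.2 1) /\
  {in Q, continuous (fun z => dt u z.1 z.2)}.

End Defs.

(* Main.v *)
(* Put w = M + e0 - u > 0, so that w_t - Lap w = - |grad w|^p, and compare a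
   directional derivative of w with K psi g(w), where
   g(w) = w/r + (w/tau)^(1/p), tau = min(r^2, t), and psi = 1 / (a b^k) blows up
   on the parabolic boundary of a smaller cylinder (a is affine in time, b is
   quadratic in space).  Only second derivatives of u exist, so the directional
   derivative is replaced by a difference quotient q: by convexity of |.|^p it
   satisfies exactly q_t - Lap q <= p |grad u|^(p-2) grad u . grad q.  At a
   maximum of q / (psi g(w)) this linear inequality makes all third-order terms
   disappear and leaves
     (p-1) g' |grad w|^p + |g''| |grad w|^2 <= (cutoff errors),
   which fails when q / (psi g(w)) is large, because g' >= 1/r,
   g' g^(p-1) >= 1/(p tau), and -g'' g controls the cross term for small w.
   The choice e0 = M - u(x, t) at the point of interest costs only a factor 2. *)
Require Import Defs.
From HB Require Import structures.
From mathcomp Require Import all_boot all_order all_algebra.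
From mathcomp Require Import all_classical all_reals all_analysis.
From mathcomp Require Import ring lra.
Import Order.TTheory GRing.Theory Num.Theory.
Import numFieldNormedType.Exports.
Local Open Scope ring_scope.
Local Open Scope classical_set_scope.

(** * Calculus of second derivatives in one variable, and the tests at a local maximum *)

Section OneVariable.
Context {R : realType}.
Implicit Types (f g : R -> R) (x a b c d : R).

(* Differentiable near [x], with first derivative [a] and second derivative [b]
   at [x]. *)
Definition has_d2 f x a b : Prop := exists f1 : R -> R,
  [/\ \forall r \near x, is_derive r (1 : R) f (f1 r), f1 x = a & is_derive x (1 : R) f1 b].

Lemma is_derive1_cts f x a : is_derive x (1 : R) f a -> {for x, continuous f}.
Proof.
by case=> fx _; apply: differentiable_continuous; exact/derivable1_diffP.
Qed.

Lemma has_d2_is_derive f x a b : has_d2 f x a b -> is_derive x (1 : R) f a.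
Proof. by move=> [f1 [nf <- _]]; exact: nbhs_singleton nf. Qed.

Lemma has_d2_cst c x : has_d2 (fun=> c) x 0 0.
Proof.
exists (fun=> 0); split => //; last exact: is_derive_cst.
by near=> r; exact: is_derive_cst.
Unshelve. all: by end_near. Qed.

Lemma has_d2D f g x a b c d : has_d2 f x a b -> has_d2 g x c d ->
  has_d2 (fun r => f r + g r) x (a + c) (b + d).
Proof.
move=> [f1 [nf <- df]] [g1 [ng <- dg]]; exists (fun r => f1 r + g1 r); split => //.
  by near=> r; apply: is_deriveD; near: r.
exact: is_deriveD.
Unshelve. all: by end_near. Qed.

Lemma has_d2M f g x a b c d : has_d2 f x a b -> has_d2 g x c d ->
  has_d2 (fun r => f r * g r) x (a * g x + f x * c)
    (b * g x + 2 * a * c + f x * d).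
Proof.
move=> [f1 [nf fa df]] [g1 [ng gc dg]].
exists (fun r => f1 r * g r + f r * g1 r); split.
- near=> r.
  have hf : is_derive r (1 : R) f (f1 r) by near: r.
  have hg : is_derive r (1 : R) g (g1 r) by near: r.
  apply: (is_derive_eq (is_deriveM hf hg)).
  by rewrite /GRing.scale /= addrC [g r * _]mulrC.
- by rewrite fa gc.
- have hf := nbhs_singleton nf; have hg := nbhs_singleton ng.
  apply: (is_derive_eq (is_deriveD (is_deriveM df hg) (is_deriveM hf dg))).
  by rewrite /GRing.scale /= fa gc; ring.
Unshelve. all: by end_near. Qed.

Lemma has_d2Z f x a b c : has_d2 f x a b -> has_d2 (fun r => c * f r) x (c * a) (c * b).
Proof.
move=> hf; have := has_d2M _ _ _ _ _ _ _ (has_d2_cst c x) hf.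
by rewrite /= !mul0r mulr0 mul0r !add0r.
Qed.

Lemma has_d2_comp f g x a b c d : has_d2 g x a b -> has_d2 f (g x) c d ->
  has_d2 (fun r => f (g r)) x (c * a) (d * a ^+ 2 + c * b).
Proof.
move=> [g1 [ng ga dg]] [f1 [nf fc df]].
exists (fun r => f1 (g r) * g1 r); split.
- have gc : {for x, continuous g} := is_derive1_cts _ _ _ (nbhs_singleton ng).
  near=> r.
  have hf : is_derive (g r) (1 : R) f (f1 (g r)) by near: r; exact: (gc _ nf).
  have hg : is_derive r (1 : R) g (g1 r) by near: r.
  exact: (is_derive1_comp hf hg).
- by rewrite fc ga.
- have hg := nbhs_singleton ng.
  apply: (is_derive_eq (is_deriveM (@is_derive1_comp _ f1 g _ _ _ df hg) dg)).
  by rewrite /GRing.scale /= fc ga; ring.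
Unshelve. all: by end_near. Qed.

(** Difference quotients with negative increment are nonnegative, hence so is their limit.
    Comparison on the left only is what is available in time, where the maximum may sit at the final
    instant. *)
Lemma is_derive_local_max_left f x a : is_derive x (1 : R) f a ->
  (\forall r \near x, r < x -> f r <= f x) -> 0 <= a.
Proof.
move=> [df <-] mx; rewrite ['D_1 f x]cvg_at_leftE; last exact: df.
apply: limr_ge.
  rewrite -(cvg_at_leftE (fun h => h^-1 *: ((f \o shift x) _ - f x))) //.
  apply: cvg_trans df; apply: cvg_app.
  move=> A [e egt0 Ae]; exists e => // y xe ygt0; apply: Ae => //.
  exact/ltr0_neq0.
move: mx => [e /= e0 mx]; near=> h.
have h0 : h < 0 by near: h; exists 1 => /=.
apply: mulr_le0; first by rewrite invr_le0 ltW.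
rewrite subr_le0 [_%:A]mulr1 /=; apply: mx; last by rewrite gtrDr.
rewrite /= (_ : x - (h + x) = - h) ?normrN; last by ring.
by near: h; exists e => // y /=; rewrite sub0r normrN.
Unshelve. all: by end_near. Qed.

(** If [b > 0], then [f1], which vanishes at [x], is positive just to the right of [x], and the mean
    value theorem makes [f] exceed [f x] there. Differentiability of [f1] at the single point [x]
    suffices; no Taylor formula or continuity of the second derivative enters. *)
Lemma has_d2_local_max f x a b : has_d2 f x a b ->
  (\forall r \near x, f r <= f x) -> a = 0 /\ b <= 0.
Proof.
move=> [f1 [nf fa df]] mx.
have a0 : a = 0.
  have hf := nbhs_singleton nf; rewrite fa in hf.
  apply/eqP; rewrite eq_le; apply/andP; split; last first.
    by apply: (is_derive_local_max_left f x) => //; apply: filterS mx.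
  (* The inequality [a <= 0] is the left-sided test applied to the reflected function. *)
  have hN : is_derive (- x) (1 : R) (f \o -%R) (- a).
    have := @is_derive1_comp _ f -%R (- x) a (-1).
    by rewrite opprK mulrN1; apply => //; exact: is_deriveNid.
  rewrite -oppr_ge0; apply: (is_derive_local_max_left _ _ _ hN).
  rewrite /= opprK.
  have cN : (-%R : R -> R) @ (- x) --> x.
    by rewrite -[X in _ --> X]opprK; exact: opp_continuous.
  have mN : \forall r \near - x, f (- r) <= f x := cN _ mx.
  by apply: filterS mN => r.
split => //; rewrite leNgt; apply/negP => b0.
have [fd fb] := df.
have : \forall h \near 0^', 0 < h^-1 *: ((f1 \o shift x) h%:A - f1 x).
  have /cvgr_gt : (h^-1 *: ((f1 \o shift x) h%:A - f1 x)) @[h --> 0^'] --> b.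
    by rewrite -fb; exact: fd.
  exact.
move=> [e1 /= e10 He1]; move: nf => [e2 /= e20 He2]; move: mx => [e3 /= e30 He3].
pose e := Num.min e1 (Num.min e2 e3) / 2.
have e0 : 0 < e by rewrite divr_gt0 // !lt_min e10 e20.
have [ee1 ee2 ee3] : [/\ e < e1, e < e2 & e < e3].
  have : e < Num.min e1 (Num.min e2 e3).
    by rewrite /e ltr_pdivrMr // ltr_pMr ?ltr1n // !lt_min e10 e20.
  by rewrite !lt_min => /and3P[].
have f1pos r : 0 < r <= e -> 0 < f1 (r + x).
  move=> /andP[r0 re].
  have := He1 r; rewrite /= sub0r normrN gtr0_norm // fa a0 subr0.
  rewrite [_%:A]mulr1 => /(_ (le_lt_trans re ee1) (lt0r_neq0 r0)).
  by rewrite pmulr_rgt0 // invr_gt0.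
have : exists2 c, c \in `]x, e + x[%R & f (e + x) - f x = f1 c * (e + x - x).
  apply: MVT; first by rewrite ltrDr.
    move=> c; rewrite in_itv /= => /andP[xc cx]; apply: He2.
    rewrite /= distrC gtr0_norm ?subr_gt0 // (lt_trans _ ee2) //.
    by rewrite ltrBlDr.
  apply: derivable_within_continuous => c; rewrite in_itv /= => /andP[xc cx].
  have [] // := He2 c; rewrite /= distrC ger0_norm ?subr_ge0 // (le_lt_trans _ ee2) //.
  by rewrite lerBlDr.
move=> [c]; rewrite in_itv /= => /andP[xc cx]; rewrite addrK => fE.
have : f (e + x) <= f x.
  by apply: He3; rewrite /= (_ : x - (e + x) = - e) ?normrN ?gtr0_norm //; ring.
have : 0 < f1 c.
  by rewrite -[c](subrK x); apply: f1pos; rewrite subr_gt0 xc lerBlDr ltW.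
move=> fc0 fex; have := mulr_gt0 fc0 e0; rewrite -fE subr_gt0.
by rewrite ltNge fex.
Unshelve. all: by end_near. Qed.

Lemma has_d2_powR (p x : R) : 0 < x ->
  has_d2 (fun y => y `^ p) x (p * x `^ (p - 1)) (p * ((p - 1) * x `^ (p - 2))).
Proof.
move=> x0; exists (fun y => p * y `^ (p - 1)); split => //.
  near=> r; apply: is_derive1_powR; near: r; exact: lt_nbhsr.
have h := is_derive1_powR (p - 1) x0.
apply: (is_derive_eq (is_deriveZ p h)).
by rewrite /GRing.scale /= -addrA -opprD.
Unshelve. all: by end_near. Qed.

Lemma has_d2_expV (k : nat) x : 0 < x ->
  has_d2 (fun y => y ^- k) x (- k%:R * x ^- k.+1) (k%:R * k.+1%:R * x ^- k.+2).
Proof.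
have dV (m : nat) (y : R) : y != 0 ->
    is_derive y (1 : R) (fun z => z ^- m) (- m%:R * y ^- m.+1).
  move=> y0; have hX : is_derive y (1 : R) (fun z => z ^+ m) (m%:R * y ^+ m.-1).
    apply: DeriveDef; first exact: exprn_derivable.
    by rewrite exp_derive /GRing.scale /= mulr1.
  apply: (is_derive_eq (@is_deriveV _ _ _ _ _ _ hX)); first by rewrite expf_neq0.
  case: m hX => [|m] _; rewrite /GRing.scale /= ?mul0r ?oppr0 ?mul0r ?mulr0 //.
  by rewrite !exprS; field; rewrite expf_neq0.
move=> x0; exists (fun y => - k%:R * y ^- k.+1); split => //.
  by near=> r; apply/dV/lt0r_neq0; near: r; exact: lt_nbhsr.
have h := dV k.+1 x (lt0r_neq0 x0).
apply: (is_derive_eq (is_deriveZ (- k%:R) h)).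
by rewrite /GRing.scale /=; ring.
Unshelve. all: by end_near. Qed.

End OneVariable.

(** * Convexity inequalities and the algebra at a maximum point *)

Section Inequalities.
Context {R : realType}.

(** Young's inequality for [y] and [x^(p-1)] with the conjugate exponents [p] and [p/(p-1)]. *)
Lemma powR_tangent_le (p x y : R) : 1 < p -> 0 <= x -> 0 <= y ->
  p * x `^ (p - 1) * y <= y `^ p + (p - 1) * x `^ p.
Proof.
move=> p1 x0 y0; have p0 : 0 < p := lt_trans ltr01 p1.
have pm : 0 < p - 1 by rewrite subr_gt0.
have := @conjugate_powR R y (x `^ (p - 1)) p (p / (p - 1)) y0 (powR_ge0 _ _) p0.
rewrite -powRrM => /(_ (divr_gt0 p0 pm)).
have -> : (p - 1) * (p / (p - 1)) = p by field; rewrite gt_eqF.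
have -> : p^-1 + (p / (p - 1))^-1 = 1 by field; rewrite !gt_eqF.
move=> /(_ erefl) => h.
have -> : p * x `^ (p - 1) * y = p * (y * x `^ (p - 1)) by ring.
have -> : y `^ p + (p - 1) * x `^ p = p * (y `^ p / p + x `^ p / (p / (p - 1))).
  by field; rewrite !gt_eqF.
by rewrite ler_pM2l.
Qed.

Lemma cauchy_schwarz_sqrt n (a b : 'I_n -> R) :
  `|\sum_i a i * b i| <=
  Num.sqrt (\sum_i a i ^+ 2) * Num.sqrt (\sum_i b i ^+ 2).
Proof.
set A := \sum_i a i ^+ 2; set B := \sum_i b i ^+ 2; set S := \sum_i a i * b i.
have A0 : 0 <= A by apply: sumr_ge0 => i _; exact: sqr_ge0.
have B0 : 0 <= B by apply: sumr_ge0 => i _; exact: sqr_ge0.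
rewrite -sqrtrM // -sqrtr_sqr; apply: ler_wsqrtr.
have key s : 0 <= A - 2 * s * S + s ^+ 2 * B.
  have -> : A - 2 * s * S + s ^+ 2 * B = \sum_i (a i - s * b i) ^+ 2.
    rewrite /A /B /S !mulr_sumr -sumrB -big_split /=.
    by apply: eq_bigr => i _; ring.
  by apply: sumr_ge0 => i _; exact: sqr_ge0.
have [B1|] := ltP 0 B.
  have := key (S / B).
  have -> : A - 2 * (S / B) * S + (S / B) ^+ 2 * B = (A * B - S ^+ 2) / B.
    by field; rewrite gt_eqF.
  by rewrite pmulr_lge0 ?invr_gt0 // subr_ge0.
move=> B1; have B2 : B = 0 by apply/eqP; rewrite eq_le B1.
suff -> : S = 0 by rewrite expr0n mulr_ge0.
apply: big1 => i _; move/eqP: B2; rewrite psumr_eq0; last by move=> ? _; exact: sqr_ge0.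
by move=> /allP /(_ i (mem_index_enum _)); rewrite sqrf_eq0 => /eqP ->; rewrite mulr0.
Qed.

(* Convexity of [v |-> |v|^p], in the form that survives division by |Q|. *)
Lemma enorm_powR_convex n (p : R) (P Q : 'I_n -> R) : 1 < p ->
  let N := Num.sqrt (\sum_i Q i ^+ 2) in 0 < N ->
  p * N `^ (p - 1) / N * \sum_i Q i * (P i - Q i) <=
  Num.sqrt (\sum_i P i ^+ 2) `^ p - N `^ p.
Proof.
move=> p1 N N0; set Y := Num.sqrt (\sum_i P i ^+ 2).
have p0 : 0 < p := lt_trans ltr01 p1.
have QQ : \sum_i Q i * Q i = N ^+ 2.
  rewrite sqr_sqrtr; last by apply: sumr_ge0 => i _; exact: sqr_ge0.
  by apply: eq_bigr => i _; rewrite expr2.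
have -> : \sum_i Q i * (P i - Q i) = \sum_i Q i * P i - N ^+ 2.
  by rewrite -QQ -sumrB; apply: eq_bigr => i _; rewrite mulrBr.
have QP : \sum_i Q i * P i <= N * Y.
  exact: le_trans (ler_norm _) (cauchy_schwarz_sqrt _ _ _).
have := @powR_tangent_le p N Y p1 (ltW N0) (sqrtr_ge0 _).
have NE : N `^ p = N * N `^ (p - 1) by rewrite mulr_powRB1 // ltW.
rewrite NE; set m := N `^ (p - 1) => h.
have m0 : 0 < m by rewrite powR_gt0.
have : p * m / N * (\sum_i Q i * P i - N ^+ 2) <= p * m / N * (N * Y - N ^+ 2).
  by rewrite ler_pM2l ?lerB // !(mulr_gt0, invr_gt0).
have -> : p * m / N * (N * Y - N ^+ 2) = p * m * Y - p * m * N.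
  by field; rewrite gt_eqF.
by move=> /le_trans; apply; nra.
Qed.

(* With [A = (w / tau)^(1/p) / w]: [g = w/r + (w/tau)^(1/p)], [g1 = g'(w)],
   [X = |grad w| / g] at the maximum point; the factor of [(X * g) ^ 2] is
   [- g''(w)]. *)
Lemma barrier_gap (p r tau w A a b X B c1 t0 : R) (k : nat) :
  1 < p -> 0 < r -> 0 < tau -> tau <= r ^+ 2 -> tau <= t0 -> 0 < w ->
  A = (w / tau) `^ p^-1 / w ->
  0 < a <= 1 -> 0 < b <= 1 -> (2 <= k)%N -> 1 <= k%:R * (p - 1) ->
  0 <= c1 -> 1 <= B ->
  ((c1 + 2) * p + 4 * p * k%:R + 16 * k%:R * p) < B * (p - 1) ->
  16 * k%:R * p ^+ 2 < B * (p - 1) ->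
  B ^+ k / (a * b ^+ k) <= X ->
  forall g g1 : R, g = w * (r^-1 + A) -> g1 = r^-1 + A / p ->
  g * (c1 / (r ^+ 2 * b ^+ 2) + 2 / (t0 * a))
    + 4 * p * k%:R * g * (X * g) `^ (p - 1) / (r * b)
    + 8 * k%:R * g1 * (X * g) / (r * b)
  < (p - 1) * g1 * (X * g) `^ p
    + p^-1 * (1 - p^-1) * A / w * (X * g) ^+ 2.
Proof.
move=> p1 r0 tau0 taur taut w0 AE /andP[a0 a1] /andP[b0 b1] k2 kp c10 B1 hB1 hB2 hX g g1 gE g1E.
have p0 : 0 < p := lt_trans ltr01 p1.
have t00 : 0 < t0 := lt_le_trans tau0 taut.
have pm : 0 < p - 1 by rewrite subr_gt0.
have B0 : 0 < B := lt_le_trans ltr01 B1.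
have A0 : 0 < A by rewrite AE divr_gt0 // powR_gt0 // divr_gt0.
have ri0 : 0 < r^-1 by rewrite invr_gt0.
have g0 : 0 < g by rewrite gE mulr_gt0 // addr_gt0.
have Ap0 : 0 < A / p by rewrite divr_gt0.
have g10 : 0 < g1 by rewrite g1E addr_gt0.
have k0 : 0 < (k%:R : R) by rewrite ltr0n (leq_trans _ k2).
have Bb1 : 1 <= B / b by rewrite ler_pdivlMr // mul1r (le_trans b1).
have ai1 : 1 <= a^-1 by rewrite invf_ge1.
have bi1 : 1 <= b^-1 by rewrite invf_ge1.
have Bk2 : B <= B ^+ k by rewrite -{1}[B]expr1 ler_weXn2l // (leq_trans _ k2).
have bk : b^-2 <= b^-1 ^+ k by rewrite -exprVn ler_weXn2l.
(* The lower bound on [X] is split into one bound per error term: [B/a] for the time cutoff, [B/b^2]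
   (where [k >= 2] is used) for second derivatives of the space cutoff, [B/b] for first-order terms,
   and [X^(p-1) >= B/b] (where [k (p-1) >= 1] is used) for the cross term. *)
have hX' : a^-1 * (B / b) ^+ k <= X.
  suff -> : a^-1 * (B / b) ^+ k = B ^+ k / (a * b ^+ k) by [].
  by rewrite expr_div_n; field; rewrite expf_neq0 !gt_eqF.
have X1 : (B / b) ^+ k <= X.
  by apply: le_trans hX'; rewrite ler_peMl // exprn_ge0 // divr_ge0 // ltW.
have X0 : 1 <= X by apply: le_trans X1; rewrite exprn_ege1.
have Xp : 0 < X := lt_le_trans ltr01 X0.
have Xa : B * a^-1 <= X.
  apply: le_trans hX'; rewrite mulrC ler_pM2l ?invr_gt0 //.
  apply: (@le_trans _ _ (B / b)); first by rewrite ler_pdivlMr // ger_pMr.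
  by rewrite -{1}[B / b]expr1 ler_weXn2l // (leq_trans _ k2).
have Xb2 : B * b^-2 <= X.
  apply: le_trans X1; rewrite expr_div_n -[b ^- k]exprVn.
  by apply: ler_pM => //; rewrite ?invr_ge0 ?sqr_ge0 // ltW.
have Xb : B * b^-1 <= X.
  apply: le_trans X1; rewrite -{1}[B / b]expr1 ler_weXn2l // (leq_trans _ k2) //.
have Xpb : B * b^-1 <= X `^ (p - 1).
  apply: (@le_trans _ _ (((B / b) ^+ k) `^ (p - 1))).
    rewrite -powR_mulrn; last by rewrite divr_ge0 // ltW.
    by rewrite -powRrM le1r_powR.
  by apply: ge0_ler_powR; rewrite ?nnegrE ?exprn_ge0 ?divr_ge0 // ltW.
have XpE : X `^ p = X * X `^ (p - 1) by rewrite mulr_powRB1 // ltW.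
have Xp1 : 1 <= X `^ (p - 1).
  by apply: le_trans Xpb; rewrite (le_trans _ Bb1).
set Y := X `^ (p - 1) in Xpb XpE Xp1.
rewrite !powRM ?(ltW Xp) ?(ltW g0) // -/Y XpE.
set G := g `^ (p - 1); have G0 : 0 < G by rewrite powR_gt0.
have gpE : g `^ p = g * G by rewrite mulr_powRB1 // ltW.
rewrite gpE.
pose E := g1 * G.
have E0 : 0 < E by rewrite mulr_gt0.
(* Since [g >= w A = (w/tau)^(1/p)] and [p g1 >= A], the product [p g1 g^(p-1)] is at least
   [A (w A)^(p-1) = (w A)^p / w = 1/tau]. *)
have Etau : tau^-1 <= p * E.
  have wA : w * A <= g by rewrite gE ler_pM2l // lerDr ltW.
  have wA0 : 0 < w * A by rewrite mulr_gt0.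
  have GA : (w * A) `^ (p - 1) <= G.
    by apply: ge0_ler_powR; rewrite ?nnegrE ?(ltW pm) ?(ltW wA0) ?(ltW g0).
  have wAp : (w * A) `^ p = w / tau.
    have -> : w * A = (w / tau) `^ p^-1 by rewrite AE mulrC divfK // gt_eqF.
    by rewrite -powRrM mulVf ?gt_eqF // powRr1 // ltW // divr_gt0.
  have tE : tau^-1 = A * (w * A) `^ (p - 1).
    have : w * A * (w * A) `^ (p - 1) = w / tau by rewrite mulr_powRB1 // ltW.
    by rewrite -mulrA => /(mulfI (lt0r_neq0 w0)).
  rewrite tE /E mulrA; apply: ler_pM => //; rewrite ?powR_ge0 ?ltW //.
  by rewrite g1E mulrDr mulrCA divff ?gt_eqF // mulr1 ltrDr mulr_gt0.
have rtau : r^-2 <= tau^-1 by rewrite lef_pV2 ?posrE // exprn_gt0.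
have ttau : t0^-1 <= tau^-1 by rewrite lef_pV2 ?posrE.
(* Every error term is a small multiple of [E * X * Y] or of
   [A * (r^-1 + A) * X ^ 2]. *)
have XY0 : 0 < X * Y by rewrite mulr_gt0 // (lt_le_trans ltr01).
have Y0 : 0 < Y := lt_le_trans ltr01 Xp1.
have X_XY : X <= X * Y by rewrite ler_peMr // ltW.
have bi0 : 0 < b^-1 by rewrite invr_gt0.
have ai0 : 0 < a^-1 by rewrite invr_gt0.
have rg1 : r^-1 <= g1 by rewrite g1E lerDl ltW.
have T1 : B * (c1 / (r ^+ 2 * b ^+ 2)) <= c1 * p * (E * (X * Y)).
  have -> : B * (c1 / (r ^+ 2 * b ^+ 2)) = c1 * (r^-2 * (B * b^-2)).
    by field; rewrite !gt_eqF.
  have -> : c1 * p * (E * (X * Y)) = c1 * ((p * E) * (X * Y)) by ring.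
  apply: ler_wpM2l => //; apply: ler_pM; rewrite ?invr_ge0 ?sqr_ge0 //.
  - by rewrite mulr_ge0 ?invr_ge0 ?sqr_ge0 // ltW.
  - exact: le_trans rtau Etau.
  - exact: le_trans Xb2 X_XY.
have T2 : B * (2 / (t0 * a)) <= 2 * p * (E * (X * Y)).
  have -> : B * (2 / (t0 * a)) = 2 * (t0^-1 * (B * a^-1)).
    by field; rewrite !gt_eqF.
  have -> : 2 * p * (E * (X * Y)) = 2 * ((p * E) * (X * Y)) by ring.
  apply: ler_wpM2l => //; apply: ler_pM; rewrite ?mulr_ge0 ?invr_ge0 ?(ltW t00) ?(ltW B0) ?(ltW a0) //.
  - exact: le_trans ttau Etau.
  - exact: le_trans Xa X_XY.
have T3 : B * (4 * p * k%:R * (Y * G) / (r * b)) <= 4 * p * k%:R * (E * (X * Y)).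
  have -> : B * (4 * p * k%:R * (Y * G) / (r * b)) =
      4 * p * k%:R * (Y * G) * (r^-1 * (B * b^-1)) by field; rewrite !gt_eqF.
  have -> : 4 * p * k%:R * (E * (X * Y)) = 4 * p * k%:R * (Y * G) * (g1 * X).
    by rewrite /E; ring.
  apply: ler_wpM2l; first by rewrite !mulr_ge0 ?powR_ge0 ?(ltW p0) ?(ltW k0).
  by apply: ler_pM => //; rewrite ?mulr_ge0 ?(ltW ri0) ?(ltW B0) ?(ltW bi0).
have T4 : B * (8 * k%:R * g1 * X / (r * b)) <=
    16 * k%:R * p * (E * (X * Y)) + 16 * k%:R * (A * (r^-1 + A) * X ^+ 2).
  have -> : B * (8 * k%:R * g1 * X / (r * b)) =
      8 * k%:R * (X * (g1 * (r^-1 * (B * b^-1)))) by field; rewrite !gt_eqF.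
  have ApA : A / p <= A by rewrite ler_pdivrMr // ler_peMr // ltW.
  have U0 : 0 <= 16 * k%:R * (A * (r^-1 + A) * X ^+ 2).
    by rewrite !mulr_ge0 ?sqr_ge0 ?addr_ge0 // ltW.
  have S0 : 0 <= 16 * k%:R * p * (E * (X * Y)) by rewrite !mulr_ge0 // ltW.
  (* For [A >= 1/r] (small [w]) one has [g1 <= 2 A], and the concavity term absorbs the cross term.
     Otherwise [g1 <= 2/r], and [1/r^2 <= 1/tau <= p E] lets the gradient term do it. *)
  have [Ar|rA] := leP r^-1 A.
    apply: (@le_trans _ _ (16 * k%:R * (A * (r^-1 + A) * X ^+ 2))); last first.
      by rewrite lerDr.
    have -> : 16 * k%:R * (A * (r^-1 + A) * X ^+ 2) =
      8 * k%:R * (X * (2 * A * ((r^-1 + A) * X))) by ring.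
    rewrite ler_pM2l ?mulr_gt0 // ler_pM2l //.
    apply: ler_pM; rewrite ?(ltW g10) //.
    - by rewrite !mulr_ge0 // ltW.
    - by rewrite g1E; lra.
    - apply: ler_pM => //; rewrite ?mulr_ge0 ?(ltW ri0) ?(ltW B0) ?(ltW bi0) //.
      by rewrite lerDl ltW.
  apply: (@le_trans _ _ (16 * k%:R * p * (E * (X * Y)))); last by rewrite lerDl.
  have -> : 16 * k%:R * p * (E * (X * Y)) = 8 * k%:R * (X * (2 * (p * E) * Y)).
    by ring.
  rewrite ler_pM2l ?mulr_gt0 // ler_pM2l // [leLHS]mulrA.
  apply: ler_pM => //; rewrite ?mulr_ge0 ?(ltW ri0) ?(ltW B0) ?(ltW bi0) ?(ltW g10) //.
  apply: (@le_trans _ _ (2 * r^-2)); last first.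
    by apply: ler_wpM2l => //; exact: le_trans rtau Etau.
  have -> : 2 * r^-2 = 2 * r^-1 * r^-1 by field; rewrite gt_eqF.
  by rewrite ler_pM2r // g1E; lra.
set S := E * (X * Y) in T1 T2 T3 T4; set U := A * (r^-1 + A) * X ^+ 2 in T4.
have S0 : 0 < S by rewrite mulr_gt0.
have U0 : 0 < U by rewrite !mulr_gt0 ?addr_gt0 // exprn_gt0.
have -> : (p - 1) * g1 * (X * Y * (g * G)) + p^-1 * (1 - p^-1) * A / w * (X * g) ^+ 2
    = g * ((p - 1) * S + (p - 1) / p ^+ 2 * U).
  by rewrite /S /E /U gE; field; rewrite !gt_eqF.
have -> : g * (c1 / (r ^+ 2 * b ^+ 2) + 2 / (t0 * a))
    + 4 * p * k%:R * g * (Y * G) / (r * b) + 8 * k%:R * g1 * (X * g) / (r * b)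
  = g * (c1 / (r ^+ 2 * b ^+ 2) + 2 / (t0 * a)
    + 4 * p * k%:R * (Y * G) / (r * b) + 8 * k%:R * g1 * X / (r * b)).
  by ring.
rewrite ltr_pM2l // -(ltr_pM2l B0).
have h1 : (c1 + 2) * p * S + 4 * p * k%:R * S + 16 * k%:R * p * S < B * (p - 1) * S.
  by rewrite -!mulrDl ltr_pM2r.
have h2 : 16 * k%:R * U < B * ((p - 1) / p ^+ 2) * U.
  by rewrite ltr_pM2r // mulrA ltr_pdivlMr // exprn_gt0.
rewrite !(mulrDr B) [B * ((p - 1) * S)]mulrA [B * ((p - 1) / p ^+ 2 * U)]mulrA.
lra.
Qed.

End Inequalities.

(* [P], [Q]: gradients at [x + h] and at [x]; [PP], [QQ]: pure second
   derivatives; [Pt], [Qt]: time derivatives.  The three hypotheses on them are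
   the first and second order conditions for a maximum of
   [- (u(x + h) - u(x)) / d - K psi g]. *)
Lemma maximum_point_inequality {R : realType} n (p K d r b a t0 g g1 g2 : R) (k : nat)
    (x P Q PP QQ : 'I_n -> R) (Pt Qt : R) :
  let N := Num.sqrt (\sum_i Q i ^+ 2) in
  let phi i := 4 * k%:R * x i / (r ^+ 2 * b) in
  1 < p -> 0 < K -> 0 < d -> 0 < r -> 0 < b <= 1 -> 0 < N -> 0 < g -> 0 <= g1 ->
  \sum_i x i ^+ 2 <= r ^+ 2 / 2 ->
  Pt - \sum_i PP i = Num.sqrt (\sum_i P i ^+ 2) `^ p ->
  Qt - \sum_i QQ i = N `^ p ->
  (forall i, - (P i - Q i) / d = K * (phi i * g - g1 * Q i)) ->
  (forall i, - (PP i - QQ i) / d <=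
     K * ((k%:R * k.+1%:R * 16 * x i ^+ 2 / (r ^+ 4 * b ^+ 2)
            + 4 * k%:R / (r ^+ 2 * b)) * g
          - 2 * phi i * g1 * Q i - g2 * Q i ^+ 2 - g1 * QQ i)) ->
  K * (- (2 / (t0 * a)) * g - g1 * Qt) <= - (Pt - Qt) / d ->
  (p - 1) * g1 * N `^ p + g2 * N ^+ 2 <=
    g * ((8 * k%:R * k.+1%:R + 4 * k%:R * n%:R) / (r ^+ 2 * b ^+ 2) + 2 / (t0 * a))
    + 4 * p * k%:R * g * N `^ (p - 1) / (r * b) + 8 * k%:R * g1 * N / (r * b).
Proof.
move=> N phi p1 K0 d0 r0 /andP[b0 b1] N0 g0 g10 xr pdeP pdeQ D1 D2 Dt.
have p0 : 0 < p := lt_trans ltr01 p1.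
set m := N `^ (p - 1); have m0 : 0 < m by rewrite powR_gt0.
have NE : N `^ p = N * m by rewrite mulr_powRB1 // ltW.
have QQ2 : \sum_i Q i ^+ 2 = N ^+ 2.
  by rewrite sqr_sqrtr //; apply: sumr_ge0 => i _; exact: sqr_ge0.
pose T := \sum_i phi i * Q i.
have TN : `|T| <= 4 * k%:R / (r * b) * N.
  apply: le_trans (cauchy_schwarz_sqrt _ _ _) _; rewrite -/N ler_wpM2r ?(ltW N0) //.
  have e0 : 0 <= 4 * k%:R / (r * b) by rewrite divr_ge0 ?mulr_ge0 // ltW.
  rewrite -[4 * k%:R / (r * b)]ger0_norm // -sqrtr_sqr; apply: ler_wsqrtr.
  have -> : \sum_i phi i ^+ 2 = (4 * k%:R / (r ^+ 2 * b)) ^+ 2 * \sum_i x i ^+ 2.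
    rewrite mulr_sumr; apply: eq_bigr => i _; rewrite /phi; ring.
  apply: (@le_trans _ _ ((4 * k%:R / (r ^+ 2 * b)) ^+ 2 * r ^+ 2)).
    apply: ler_wpM2l; first exact: sqr_ge0.
    by apply: le_trans xr _; rewrite ler_pdivrMr // ler_peMr ?sqr_ge0 // ler1n.
  by rewrite le_eqVlt; apply/orP; left; apply/eqP; field; rewrite !gt_eqF.
pose chi := \sum_i (k%:R * k.+1%:R * 16 * x i ^+ 2 / (r ^+ 4 * b ^+ 2)
            + 4 * k%:R / (r ^+ 2 * b)).
have chiE : chi <= (8 * k%:R * k.+1%:R + 4 * k%:R * n%:R) / (r ^+ 2 * b ^+ 2).
  have -> : chi = k%:R * k.+1%:R * 16 / (r ^+ 4 * b ^+ 2) * (\sum_i x i ^+ 2)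
      + 4 * k%:R / (r ^+ 2 * b) * n%:R.
    rewrite /chi big_split /= sumr_const card_ord -[_ *+ n]mulr_natr; congr (_ + _).
    by rewrite mulr_sumr; apply: eq_bigr => i _; ring.
  rewrite (mulrDl (8 * k%:R * k.+1%:R)); apply: lerD.
    have -> : 8 * k%:R * k.+1%:R / (r ^+ 2 * b ^+ 2) =
        k%:R * k.+1%:R * 16 / (r ^+ 4 * b ^+ 2) * (r ^+ 2 / 2).
      by field; rewrite !gt_eqF.
    apply: ler_wpM2l => //.
    by rewrite divr_ge0 ?mulr_ge0 ?exprn_ge0 ?ler0n // ltW.
  have -> : 4 * k%:R * n%:R / (r ^+ 2 * b ^+ 2) =
      4 * k%:R / (r ^+ 2 * b) * n%:R * b^-1 by field; rewrite !gt_eqF.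
  by rewrite ler_peMr ?invf_ge1 // !mulr_ge0 ?invr_ge0 ?mulr_ge0 ?sqr_ge0 // ltW.
(* Convexity will involve [P - Q] only through its scalar product with [Q], which the first-order
   condition evaluates exactly. *)
have sumD1 : - (\sum_i Q i * (P i - Q i)) / d = K * (g * T - g1 * N ^+ 2).
  rewrite -QQ2 /T !mulr_sumr -sumrB mulr_sumr mulNr mulr_suml -sumrN.
  apply: eq_bigr => i _; have := D1 i; rewrite mulNr => /(congr1 ( *%R (Q i))) e.
  transitivity (Q i * - ((P i - Q i) / d)); first by ring.
  by rewrite e; ring.
have sumD2 : - (\sum_i PP i - \sum_i QQ i) / d <=
    K * (chi * g - 2 * g1 * T - g2 * N ^+ 2 - g1 * \sum_i QQ i).
  have -> : - (\sum_i PP i - \sum_i QQ i) / d = \sum_i - (PP i - QQ i) / d.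
    by rewrite -sumrB -sumrN mulr_suml.
  apply: le_trans (ler_sum _ (fun i _ => D2 i)) _.
  rewrite -mulr_sumr ler_pM2l // !sumrB -mulr_suml -/chi -!mulr_sumr QQ2.
  rewrite le_eqVlt; apply/orP; left; apply/eqP; do 3! congr (_ - _).
  by rewrite /T mulr_sumr; apply: eq_bigr => i _; ring.
have conv := enorm_powR_convex _ p P Q p1 N0.
rewrite -/N -pdeP -pdeQ -/m in conv.
(* By the two equations, the heat operator applied to the increment of [u] is a difference of [p]-th
   powers, which convexity bounds from below; the factor [- 1/d] turns this into the upper bound
   needed here. *)
have main : K * (- (2 / (t0 * a)) * g - g1 * Qt
      - (chi * g - 2 * g1 * T - g2 * N ^+ 2 - g1 * \sum_i QQ i)) <=
    K * (p * m / N * (g * T - g1 * N ^+ 2)).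
  rewrite mulrBr; apply: le_trans (lerB Dt sumD2) _.
  rewrite mulrCA -sumD1.
  have -> : - (Pt - Qt) / d - - (\sum_i PP i - \sum_i QQ i) / d =
    - (Pt - \sum_i PP i - (Qt - \sum_i QQ i)) / d by ring.
  by rewrite !mulNr mulrN lerN2 mulrA ler_pM2r ?invr_gt0.
rewrite ler_pM2l // in main.
(* The linearized drift contributes [p g1 N^p], the equation for [u] takes back [g1 N^p]; this is
   the origin of the factor [p - 1]. *)
have NN : p * m / N * (g * T - g1 * N ^+ 2) = p * m * g / N * T - p * g1 * (N * m).
  by field; rewrite gt_eqF.
have gQ : g1 * Qt - g1 * \sum_i QQ i = g1 * (N * m) by rewrite -mulrBr pdeQ NE.
have /ler_normlP[TN1 TN2] := TN.
have t1 : p * m * g / N * T <= 4 * p * k%:R * g * m / (r * b).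
  have -> : 4 * p * k%:R * g * m / (r * b) =
      p * m * g / N * (4 * k%:R / (r * b) * N) by field; rewrite !gt_eqF.
  by apply: ler_wpM2l; rewrite // divr_ge0 ?mulr_ge0 // ltW.
have t2 : - (2 * g1 * T) <= 8 * k%:R * g1 * N / (r * b).
  have -> : 8 * k%:R * g1 * N / (r * b) =
      2 * g1 * (4 * k%:R / (r * b) * N) by field; rewrite !gt_eqF.
  by rewrite -mulrN; apply: ler_wpM2l; rewrite // mulr_ge0.
have t3 : chi * g <= (8 * k%:R * k.+1%:R + 4 * k%:R * n%:R) / (r ^+ 2 * b ^+ 2) * g.
  by rewrite ler_pM2r.
rewrite NE [g * (_ + _)]mulrDr ![g * _]mulrC.
rewrite NN in main.
have -> : (p - 1) * g1 * (N * m) = p * g1 * (N * m) - g1 * (N * m) by ring.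
rewrite [g1 * (N * m)]lock in gQ main *.
lra.
Qed.

(** * Parabolic cylinders: topology, restriction to coordinate lines, difference quotients *)

Section Cylinders.
Context {R : realType} {n : nat}.
Implicit Types (x v : 'rV[R]_n) (u : 'rV[R]_n -> R -> R).

(** The square of [enorm] is polynomial in the coordinates, so a cutoff built from it is smooth at
    the origin too. *)
Definition normsq x : R := \sum_(i < n) x 0 i ^+ 2.

Lemma normsq_ge0 x : 0 <= normsq x.
Proof. by apply: sumr_ge0 => i _; exact: sqr_ge0. Qed.

Lemma normsq_coord x i : x 0 i ^+ 2 <= normsq x.
Proof.
rewrite /normsq (bigD1 i) //= lerDl; apply: sumr_ge0 => j _; exact: sqr_ge0.
Qed.

Lemma enorm_lt x (r : R) : 0 < r -> (enorm x < r) = (normsq x < r ^+ 2).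
Proof.
move=> r0; rewrite /enorm -/(normsq x) -[X in _ < X]ger0_norm ?(ltW r0) //.
by rewrite -sqrtr_sqr ltr_sqrt // exprn_gt0.
Qed.

Lemma normsq_continuous : continuous normsq.
Proof.
rewrite /normsq; apply: continuous_big => [|i _ x]; first exact: add_continuous.
apply: (@cvg_comp _ _ _ (fun y : 'rV[R]_n => y 0 i) (fun r => r ^+ 2)).
  exact: coord_continuous.
exact: exprn_continuous.
Qed.

Lemma compact_closed_cylinder (c a b : R) :
  compact [set z : 'rV[R]_n * R | normsq z.1 <= c /\ a <= z.2 <= b].
Proof.
have -> : [set z : 'rV[R]_n * R | normsq z.1 <= c /\ a <= z.2 <= b] =
    [set x | normsq x <= c] `*` `[a, b]%classic.
  by apply/seteqP; split => -[y s] /=; rewrite in_itv.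
apply: compact_setX; last exact: segment_compact.
apply: bounded_closed_compact; last first.
  apply: (@closed_comp _ _ normsq [set y | y <= c]) => // y _.
  exact: normsq_continuous.
(* The norm on row vectors is the sup norm, and a coordinate has absolute value at most 1 or at most
   its own square, hence at most [c]. *)
exists (1 + `|c|); split; first exact: num_real.
move=> M hM x /= xc; rewrite /Num.Def.normr /= mx_normrE; apply/bigmax_leP; split.
  by apply: ltW; apply: le_lt_trans hM; rewrite addr_ge0.
move=> [i j] _ /=; rewrite ord1; apply: ltW; apply: le_lt_trans hM.
have h : x 0 j ^+ 2 <= c := le_trans (normsq_coord x j) xc.
have [h1|h1] := leP `|x 0 j| 1; first by apply: le_trans h1 _; rewrite lerDl.
apply: (@le_trans _ _ `|c|); last by rewrite lerDr.
apply: le_trans (ler_norm c); apply: le_trans h.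
by rewrite -[x 0 j ^+ 2]ger0_norm ?sqr_ge0 // normrX expr2 ler_peMl // ltW.
Qed.

Lemma near_cyl (r T : R) (z : 'rV[R]_n * R) : 0 < r -> cyl r T z ->
  \forall y \near z, cyl r T y.
Proof.
move=> r0 [zr /andP[z0 zT]]; rewrite enorm_lt // in zr.
have c1 : (fun y : 'rV[R]_n * R => normsq y.1) @ z --> normsq z.1.
  by apply: cvg_comp; [exact: cvg_fst | exact: normsq_continuous].
have c2 : (fun y : 'rV[R]_n * R => y.2) @ z --> z.2 by exact: cvg_snd.
near=> y; split; first by rewrite enorm_lt //; near: y; exact: (cvgr_lt _ c1).
apply/andP; split; near: y; first exact: (cvgr_gt _ c2).
exact: (cvgr_lt _ c2).
Unshelve. all: by end_near. Qed.

Lemma line_continuous x v (t : R) : {for t, continuous (fun s : R => s *: v + x)}.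
Proof.
apply: cvgD; last exact: cvg_cst.
by apply: cvgZl; exact: cvg_id.
Qed.

Lemma is_derive_line (f : 'rV[R]_n -> R) x v (t : R) :
  derivable f (t *: v + x) v ->
  is_derive t (1 : R) (fun s => f (s *: v + x)) ('D_v f (t *: v + x)).
Proof.
have E : (fun h : R => h^-1 *: (((fun s => f (s *: v + x)) \o shift t) (h *: 1)
    - f (t *: v + x))) =
    (fun h : R => h^-1 *: ((f \o shift (t *: v + x)) (h *: v) - f (t *: v + x))).
  by apply/funext => h /=; rewrite [h *: 1]mulr1 scalerDl addrA.
by move=> fD; apply: DeriveDef; rewrite /derivable ?/derive E.
Qed.

Lemma has_d2_line (Rr T : R) u x s i : 0 < Rr -> C21 (cyl Rr T) u ->
  cyl Rr T (x, s) ->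
  has_d2 (fun r => u (r *: ev R i + x) s) 0 (dx i u x s) (dx i (dx i u) x s).
Proof.
move=> Rr0 [_ [uD [_ [uDD _]]]] Qz.
exists (fun r => dx i u (r *: ev R i + x) s); split.
- have lc : (fun r : R => (r *: ev R i + x, s)) @ (0 : R) --> (x, s).
    have c1 := line_continuous x (ev R i) 0.
    rewrite /prop_for /continuous_at scale0r add0r in c1.
    exact: (cvg_pair c1 (cvg_cst s)).
  have nc : \forall r \near (0 : R), cyl Rr T (r *: ev R i + x, s).
    exact: (lc _ (near_cyl _ _ _ Rr0 Qz)).
  by apply: filterS nc => r Qr; apply: is_derive_line; exact: (uD i _ Qr).
- by rewrite scale0r add0r.
- have := @is_derive_line (fun y => dx i u y s) x (ev R i) 0.
  by rewrite scale0r add0r; apply; exact: (uDD i i _ Qz).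
Qed.

Lemma normsq_line x i (r : R) :
  normsq (r *: ev R i + x) = normsq x + 2 * x 0 i * r + r * r.
Proof.
rewrite /normsq (bigD1 i) //= [in RHS](bigD1 i) //= !mxE !eqxx /=.
rewrite (eq_bigr (fun j => x 0 j ^+ 2)); first by ring.
by move=> j ji; rewrite !mxE (negbTE ji) andbF mulr0 add0r.
Qed.

(* MVT along a coordinate line, made uniform in the base point by compactness. *)
Lemma uniform_difference_quotient (Rr T e : R) u i (D : set ('rV[R]_n * R)) :
  0 < Rr -> 0 < e -> C21 (cyl Rr T) u -> compact D -> D `<=` cyl Rr T ->
  \forall d \near 0^', forall z, D z -> cyl Rr T (d *: ev R i + z.1, z.2) /\
    `|(u (d *: ev R i + z.1) z.2 - u z.1 z.2) / d - dx i u z.1 z.2| <= e.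
Proof.
move=> Rr0 e0 uC cD DQ; have [_ [uD [duc _]]] := uC.
pose P d (z : 'rV[R]_n * R) := cyl Rr T (d *: ev R i + z.1, z.2) /\
   `|dx i u (d *: ev R i + z.1) z.2 - dx i u z.1 z.2| <= e.
have : \forall d \near (0 : R), D `<=` P d.
  apply: ((compact_near_coveringP D).1 cD R (nbhs (0 : R)) P _) => z Dz.
  have cz : (fun y : ('rV[R]_n * R) * R => (y.2 *: ev R i + y.1.1, y.1.2))
      @ (z, (0 : R)) --> z.
    have c2 : (fun y : ('rV[R]_n * R) * R => y.1.2) @ (z, (0 : R)) --> z.2.
      by apply: (@cvg_comp _ _ _ fst snd); [exact: cvg_fst|exact: cvg_snd].
    have c1 : (fun y : ('rV[R]_n * R) * R => y.2 *: ev R i + y.1.1)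
        @ (z, (0 : R)) --> (0 : R) *: ev R i + z.1.
      apply: cvgD; first by apply: cvgZl; exact: cvg_snd.
      by apply: (@cvg_comp _ _ _ fst fst); exact: cvg_fst.
    rewrite scale0r add0r in c1; rewrite {2}[z]surjective_pairing.
    exact: (cvg_pair c1 c2).
  have dz : (fun z => dx i u z.1 z.2) @ z --> dx i u z.1 z.2.
    by apply: (duc i); rewrite inE; exact: DQ.
  have e2 : 0 < e / 2 by rewrite divr_gt0.
  have n1 : \forall y \near z, cyl Rr T y /\ `|dx i u z.1 z.2 - dx i u y.1 y.2| < e / 2.
    apply: filterI; first exact: near_cyl (DQ _ Dz).
    by move/cvgrPdist_lt : dz => /(_ _ e2).
  have n2 := cz _ n1; rewrite nbhs_simpl /= in n2.
  have n3 : \forall y \near (z, (0 : R)), `|dx i u z.1 z.2 - dx i u y.1.1 y.1.2| < e / 2.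
    have c1 : (fst : ('rV[R]_n * R) * R -> _) @ (z, (0 : R)) --> z by exact: cvg_fst.
    have n4 := c1 _ n1; rewrite nbhs_simpl /= in n4.
    by apply: filterS n4 => y [].
  apply: filterS2 n2 n3 => y [/= c l1] l2; split => //.
  rewrite -(subrK (dx i u z.1 z.2) (dx i u _ _)) -addrA.
  apply: le_trans (ler_normD _ _) _; rewrite (splitr e) lerD // ltW //.
  by rewrite distrC.
move=> /nbhs_ballP [d0 /= d00 hd0]; exists d0 => //= d.
rewrite /ball_ /= sub0r normrN => dd0 dne z Dz.
(* The admissible increments found by compactness form a ball around 0, so the intermediate point
   given by the mean value theorem is admissible along with [d]. *)
have inP t : `|t| <= `|d| -> P t z.
  move=> td; apply: hd0 Dz; rewrite /ball /= sub0r normrN.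
  exact: le_lt_trans td dd0.
split; first by have [] := inP d (lexx _).
pose f t := u (t *: ev R i + z.1) z.2.
have fD t : `|t| <= `|d| -> is_derive t (1 : R) f (dx i u (t *: ev R i + z.1) z.2).
  by move=> /inP[Qt _]; apply: is_derive_line; exact: (uD i _ Qt).
have f0 : u z.1 z.2 = f 0 by rewrite /f scale0r add0r.
rewrite f0 -/(f d).
suff [t td ->] : exists2 t, `|t| <= `|d| &
    (f d - f 0) / d = dx i u (t *: ev R i + z.1) z.2 by have [] := inP t td.
have fcts a b : (forall t, t \in `[a, b]%R -> `|t| <= `|d|) ->
    {within `[a, b], continuous f}.
  by move=> h; apply: derivable_within_continuous => t tab; have [] := fD t (h t tab).
have [d1|d1] := ltP 0 d.
- have abs t : t \in `[0, d]%R -> `|t| <= `|d|.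
    by rewrite in_itv /= => /andP[? ?]; rewrite (gtr0_norm d1) ger0_norm.
  have [t td e1] := MVT d1 (fun t td => fD t (abs t (subset_itv_oo_cc td)))
    (fcts _ _ abs).
  exists t; first exact/abs/subset_itv_oo_cc.
  by rewrite e1 subr0 mulfK.
have {}d1 : d < 0 by rewrite lt_neqAle dne.
have abs t : t \in `[d, 0]%R -> `|t| <= `|d|.
  by rewrite in_itv /= => /andP[? ?]; rewrite (ltr0_norm d1) ler0_norm // lerN2.
have [t td e1] := MVT d1 (fun t td => fD t (abs t (subset_itv_oo_cc td)))
  (fcts _ _ abs).
exists t; first exact/abs/subset_itv_oo_cc.
by rewrite -opprB e1 sub0r mulrN opprK mulfK.
Unshelve. all: by end_near. Qed.

End Cylinders.

(** * The barrier: the profile in [w] and the cutoff in space *)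

Section Barrier.
Context {R : realType}.

(** At [w = M - u] this is the bracket in the final estimate, so a bound on derivatives by a
    multiple of it is already the required form. *)
Definition profile (p r tau w : R) : R := w / r + (w / tau) `^ p^-1.

(** The powers with exponents [1/p - 1] and [1/p - 2] are expressed through [A], which brings both
    derivatives to the shape used in [barrier_gap]. *)
Lemma has_d2_profile (p r tau w : R) : 0 < tau -> 0 < w ->
  let A := (w / tau) `^ p^-1 / w in
  has_d2 (profile p r tau) w (r^-1 + A / p) (- (p^-1 * (1 - p^-1) * A / w)).
Proof.
move=> tau0 w0 A.
have wt0 : 0 < w / tau by rewrite divr_gt0.
have hi : has_d2 (fun y : R => y) w 1 0.
  exists (fun=> 1); split => //; last exact: is_derive_cst.
  by near=> y; exact: is_derive_id.
have h1 := has_d2Z _ _ _ _ r^-1 hi.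
have h2 : has_d2 (fun y => (tau^-1 * y) `^ p^-1) w _ _ :=
  has_d2_comp _ (fun y => tau^-1 * y) w _ _ _ _ (has_d2Z _ _ _ _ tau^-1 hi)
    (has_d2_powR p^-1 (tau^-1 * w) _).
rewrite mulrC in h2; have {}h2 := h2 wt0.
have e1 : (w / tau) `^ (p^-1 - 1) = tau * A.
  rewrite powRB; last by rewrite (gt_eqF wt0) implybT.
  by rewrite powRr1 ?(ltW wt0) // /A; field; rewrite !gt_eqF.
have e2 : (w / tau) `^ (p^-1 - 2) = tau ^+ 2 * A / w.
  rewrite powRB; last by rewrite (gt_eqF wt0) implybT.
  by rewrite powR_mulrn ?(ltW wt0) // /A; field; rewrite !gt_eqF.
have := has_d2D _ _ _ _ _ _ _ h1 h2.
rewrite e1 e2.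
have -> : (fun y => r^-1 * y + (tau^-1 * y) `^ p^-1) = profile p r tau.
  by apply/funext => y; rewrite /profile [r^-1 * _]mulrC [tau^-1 * _]mulrC.
have -> : r^-1 * 1 + p^-1 * (tau * A) * (tau^-1 * 1) = r^-1 + A / p.
  by move: A e1 e2 (p^-1) (r^-1) => A _ _ pi ri; field; rewrite gt_eqF.
have -> // : r^-1 * 0 + (p^-1 * ((p^-1 - 1) * (tau ^+ 2 * A / w)) * (tau^-1 * 1) ^+ 2 +
    p^-1 * (tau * A) * (tau^-1 * 0)) = - (p^-1 * (1 - p^-1) * A / w).
rewrite !mulr0 add0r addr0 mulr1.
have -> : p^-1 * ((p^-1 - 1) * (tau ^+ 2 * A / w)) * tau^-1 ^+ 2 =
  p^-1 * ((p^-1 - 1) * (A / w)) * (tau * tau^-1) ^+ 2 by ring.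
by rewrite mulfV ?gt_eqF //; ring.
Unshelve. all: by end_near. Qed.

Lemma profile_gt0 (p r tau w : R) : 0 < r -> 0 < tau -> 0 < w ->
  0 < profile p r tau w.
Proof.
by move=> r0 tau0 w0; rewrite addr_gt0 ?powR_gt0 ?divr_gt0.
Qed.

Lemma profile_le (p r tau w v : R) : 0 < p -> 0 < r -> 0 < tau -> 0 < w -> w <= v ->
  profile p r tau w <= profile p r tau v.
Proof.
move=> p0 r0 tau0 w0 wv; have v0 := lt_le_trans w0 wv.
rewrite lerD ?ler_pM2r ?invr_gt0 //.
apply: ge0_ler_powR; rewrite ?nnegrE ?invr_ge0 ?divr_ge0 ?(ltW p0) ?(ltW w0) ?(ltW v0) ?(ltW tau0) //.
by rewrite ler_pM2r ?invr_gt0.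
Qed.

(** Because [2^(1/p) <= 2]. This is the price of working with [M + e0 - u], which equals [2 e0] at
    the point of interest. *)
Lemma profile_double (p r tau w : R) : 1 < p -> 0 < r -> 0 < tau -> 0 <= w ->
  profile p r tau (2 * w) <= 2 * profile p r tau w.
Proof.
move=> p1 r0 tau0 w0; rewrite /profile mulrDr mulrA lerD2l -mulrA powRM //.
  rewrite ler_wpM2r ?powR_ge0 //; apply: ler1_powR; first by rewrite ler1n.
  by rewrite invf_le1 ?ltW // (lt_trans ltr01).
by rewrite divr_ge0 // ltW.
Qed.

(** It vanishes where [|x|^2 = r^2/2], strictly inside the ball of radius [r], and is at least 1/2
    on the ball of radius [r/2]. *)
Definition cutoff {n} (r : R) (x : 'rV[R]_n) : R := 1 - 2 / r ^+ 2 * normsq x.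

Lemma cutoff_continuous {n} (r : R) (x : 'rV[R]_n) :
  cutoff r y @[y --> x] --> cutoff r x.
Proof.
have FF : Filter (nbhs x) := @nbhs_filter 'rV[R]_n x.
have h1 : (fun=> (1 : R)) @ x --> (1 : R) by exact: cvg_cst.
have h2 : 2 / r ^+ 2 * normsq y @[y --> x] --> 2 / r ^+ 2 * normsq x.
  exact: (cvgMl_tmp (@normsq_continuous R n x)).
exact: (cvgB h1 h2).
Qed.

(** On a coordinate line the cutoff is a quadratic polynomial, and [phi] is the logarithmic
    derivative of its power [-k]. The factor [b ^- k] stands in front so that it can be merged into
    the constant [K] of [maximum_point_inequality]. *)
Lemma has_d2_barrier n (p r T tau m : R) (k : nat) (u : 'rV[R]_n -> R -> R) x s i :
  0 < r -> 0 < tau -> C21 (cyl r T) u -> cyl r T (x, s) ->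
  0 < m - u x s -> 0 < cutoff r x ->
  let b := cutoff r x in let w := m - u x s in
  let A := (w / tau) `^ p^-1 / w in
  let g := profile p r tau w in let g1 := r^-1 + A / p in
  let phi := 4 * k%:R * x 0 i / (r ^+ 2 * b) in
  has_d2 (fun t => cutoff r (t *: ev R i + x) ^- k *
      profile p r tau (m - u (t *: ev R i + x) s)) 0
    (b ^- k * (phi * g - g1 * dx i u x s))
    (b ^- k * ((k%:R * k.+1%:R * 16 * x 0 i ^+ 2 / (r ^+ 4 * b ^+ 2)
            + 4 * k%:R / (r ^+ 2 * b)) * g
          - 2 * phi * g1 * dx i u x s
          - p^-1 * (1 - p^-1) * A / w * dx i u x s ^+ 2
          - g1 * dx i (dx i u) x s)).
Proof.
move=> r0 tau0 uC Qz w0 b0 b w A g g1 phi.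
have hi : has_d2 (fun y : R => y) 0 1 0.
  exists (fun=> 1); split => //; last exact: is_derive_cst.
  by near=> y; exact: is_derive_id.
have hb : has_d2 (fun t => cutoff r (t *: ev R i + x)) 0
    (- 4 * x 0 i / r ^+ 2) (- 4 / r ^+ 2).
  have h0 := has_d2D _ _ _ _ _ _ _ (has_d2_cst (normsq x) 0)
    (has_d2Z _ _ _ _ (2 * x 0 i) hi).
  have h1 := has_d2D _ _ _ _ _ _ _ h0 (has_d2M _ _ _ _ _ _ _ hi hi).
  have := has_d2D _ _ _ _ _ _ _ (has_d2_cst 1 0) (has_d2Z _ _ _ _ (- (2 / r ^+ 2)) h1).
  have -> : (fun t : R => 1 + - (2 / r ^+ 2) * (normsq x + 2 * x 0 i * t + t * t)) =
      (fun t => cutoff r (t *: ev R i + x)).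
    by apply/funext => t; rewrite /cutoff normsq_line mulNr.
  congr has_d2; first by ring.
  by field; rewrite gt_eqF.
have h0 : (0 : R) *: ev R i + x = x by rewrite scale0r add0r.
have hbk : has_d2 (fun t => cutoff r (t *: ev R i + x) ^- k) 0 _ _ :=
  has_d2_comp _ (fun t => cutoff r (t *: ev R i + x)) 0 _ _ _ _ hb
    (has_d2_expV k (cutoff r (0 *: ev R i + x)) _).
rewrite h0 in hbk; have {}hbk := hbk b0.
have hu : has_d2 (fun t => m - u (t *: ev R i + x) s) 0 (- dx i u x s) (- dx i (dx i u) x s).
  have := has_d2D _ _ _ _ _ _ _ (has_d2_cst m 0)
     (has_d2Z _ _ _ _ (-1) (has_d2_line _ _ _ _ _ i r0 uC Qz)).
  rewrite !add0r !mulN1r; congr has_d2.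
  by apply/funext => t; rewrite mulN1r.
have hg : has_d2 (fun t => profile p r tau (m - u (t *: ev R i + x) s)) 0
    (g1 * - dx i u x s)
    (- (p^-1 * (1 - p^-1) * A / w) * (- dx i u x s) ^+ 2 + g1 * - dx i (dx i u) x s).
  apply: (has_d2_comp _ _ _ _ _ _ _ hu); rewrite h0.
  exact: has_d2_profile.
have := has_d2M _ _ _ _ _ _ _ hbk hg; rewrite h0 -/b -/w -/g.
have rn : r ^+ 2 != 0 by rewrite gt_eqF // exprn_gt0.
have bn : b != 0 by rewrite gt_eqF.
have bE : b ^- k.+1 = b ^- k / b.
  by rewrite exprS invfM mulrC.
have bE2 : b ^- k.+2 = b ^- k / b ^+ 2.
  by rewrite -addn2 exprD invfM.
rewrite bE bE2 /phi; set bk := b ^- k; set h := _ / w.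
by congr has_d2; field; rewrite ?bn ?gt_eqF.
Unshelve. all: by end_near. Qed.

End Barrier.

(** * The maximum principle for the difference quotient, and the gradient estimate *)

Lemma dx_le_gradnorm {R : realType} n (u : 'rV[R]_n -> R -> R) x s i :
  `|dx i u x s| <= gradnorm u x s.
Proof.
rewrite -sqrtr_sqr; apply: ler_wsqrtr; rewrite (bigD1 i) //= lerDl.
by apply: sumr_ge0 => j _; exact: sqr_ge0.
Qed.

(* At a maximum point [(x, s)] of
   [- (u(x + d e_i) - u(x)) / |d| * a * b^k / g], exceeding [2 B^k], the barrier
   inequality is violated. *)
Lemma difference_quotient_le {R : realType} n (p B r T tau t0 m e0 d : R) (k : nat)
    (u : 'rV[R]_n -> R -> R) (i : 'I_n) :
  let D := [set z : 'rV[R]_n * R |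
             normsq z.1 <= r ^+ 2 / 2 /\ t0 / 2 <= z.2 <= t0] in
  let q z := - (u (d *: ev R i + z.1) z.2 - u z.1 z.2) / `|d| in
  1 < p -> 0 < r -> 0 < t0 < T -> 0 < tau -> tau <= r ^+ 2 -> tau <= t0 ->
  0 < e0 -> d != 0 -> (2 <= k)%N -> 1 <= k%:R * (p - 1) -> 1 <= B ->
  (8 * k%:R * k.+1%:R + 4 * k%:R * n%:R + 2) * p + 4 * p * k%:R + 16 * k%:R * p
    < B * (p - 1) ->
  16 * k%:R * p ^+ 2 < B * (p - 1) ->
  C21 (cyl r T) u ->
  (forall x t, cyl r T (x, t) -> dt u x t - lap u x t = gradnorm u x t `^ p) ->
  (forall x t, cyl r T (x, t) -> e0 <= m - u x t) ->
  (forall z, D z -> cyl r T (d *: ev R i + z.1, z.2) /\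
    `|(u (d *: ev R i + z.1) z.2 - u z.1 z.2) / d - dx i u z.1 z.2|
      <= profile p r tau e0 / 2) ->
  forall z, D z ->
    q z * (2 * z.2 / t0 - 1) * cutoff r z.1 ^+ k <=
      2 * B ^+ k * profile p r tau (m - u z.1 z.2).
Proof.
move=> D q p1 r0 /andP[t00 t0T] tau0 taur taut e00 dne k2 kp B1 hB1 hB2 uC pde uM hd.
have p0 : 0 < p := lt_trans ltr01 p1.
have d0 : 0 < `|d| by rewrite normr_gt0.
have B0 : 0 < B := lt_le_trans ltr01 B1.
have DQ z : D z -> cyl r T z.
  move=> [h1 /andP[h2 h3]]; split.
    rewrite enorm_lt //; apply: le_lt_trans h1 _.
    by rewrite ltr_pdivrMr // ltr_pMr ?ltr1n // exprn_gt0.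
  by rewrite (lt_le_trans _ h2) ?divr_gt0 //= (le_lt_trans h3).
pose w (z : 'rV[R]_n * R) := m - u z.1 z.2.
have wD z : D z -> e0 <= w z by move=> /DQ; case: z => y s; exact: uM.
have w0 z : D z -> 0 < w z by move=> /wD; exact: lt_le_trans.
pose g z := profile p r tau (w z).
have g0 z : D z -> 0 < g z by move=> /w0; exact: profile_gt0.
pose a (s : R) := 2 * s / t0 - 1.
pose b (x : 'rV[R]_n) := cutoff r x.
have aD z : D z -> 0 <= a z.2 <= 1.
  move=> [_ /andP[h1 h2]]; rewrite subr_ge0 lerBlDr ler_pdivlMr // ler_pdivrMr //.
  by apply/andP; split; lra.
have bD z : D z -> 0 <= b z.1 <= 1.
  move=> [h _]; rewrite subr_ge0 gerBl mulr_ge0 ?normsq_ge0 ?divr_ge0 ?sqr_ge0 // andbT.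
  by rewrite mulrAC ler_pdivrMr ?exprn_gt0 // mul1r mulrC -ler_pdivlMr.
have DE x s : 0 <= b x -> t0 / 2 <= s <= t0 -> D (x, s).
  move=> bx ss; split => //=; move: bx.
  by rewrite subr_ge0 mulrAC ler_pdivrMr ?exprn_gt0 // mul1r mulrC -ler_pdivlMr.
(* Multiplying by [a b^k], instead of dividing by the singular barrier, gives a function continuous
   on all of the compact [D] that vanishes at the initial time [t0/2] and on the lateral boundary. A
   positive maximum therefore lies off the parabolic boundary. *)
pose J z := q z * a z.2 * b z.1 ^+ k / g z.
have cD : compact D by exact: compact_closed_cylinder.
have cJ : {in D, continuous J}.
  move=> z; rewrite inE => Dz; have Qz := DQ _ Dz; have [Qs _] := hd _ Dz.
  have FF : Filter (nbhs z) := @nbhs_filter ('rV[R]_n * R)%type z.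
  have cu : (fun y => u y.1 y.2) @ z --> u z.1 z.2 by apply: uC.1; rewrite inE.
  have c1 : (fun y : 'rV[R]_n * R => y.1) @ z --> z.1 by exact: cvg_fst.
  have c2 : (fun y : 'rV[R]_n * R => y.2) @ z --> z.2 by exact: cvg_snd.
  have cs : (fun y => d *: ev R i + y.1) @ z --> d *: ev R i + z.1.
    exact: (cvgD (cvg_cst (d *: ev R i)) c1).
  have cus : (fun y => u (d *: ev R i + y.1) y.2) @ z --> u (d *: ev R i + z.1) z.2.
    apply: (cvg_comp _ (fun y => u y.1 y.2) (cvg_pair cs c2)).
    by apply: (uC.1 (_, _)); rewrite inE.
  have cq : q @ z --> q z by exact: (cvgMr_tmp (cvgN (cvgB cus cu))).
  have ca : (fun y => a y.2) @ z --> a z.2.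
    exact: (cvgB (cvgMr_tmp (cvgMl_tmp c2)) (cvg_cst (1 : R))).
  have cb : (fun y => b y.1) @ z --> b z.1.
    exact: (cvg_comp _ _ c1 (cutoff_continuous r z.1)).
  have cbk : (fun y => b y.1 ^+ k) @ z --> b z.1 ^+ k.
    exact: (cvg_comp _ (fun y => y ^+ k) cb (@exprn_continuous _ k _)).
  have cw : w @ z --> w z by exact: (cvgB (cvg_cst m) cu).
  have cg : g @ z --> g z.
    apply: (cvg_comp _ _ cw).
    exact: (is_derive1_cts _ _ _ (has_d2_is_derive _ _ _ _
      (has_d2_profile p r tau (w z) tau0 (w0 z Dz)))).
  have gn : g z != 0 by rewrite gt_eqF // g0.
  exact: (cvgM (cvgM (cvgM cq ca) cbk) (cvgV gn cg)).
move=> z0 Dz0; rewrite -/(a _) -/(b _) -/(w z0) -/(g z0).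
rewrite -ler_pdivrMr ?g0 // -/(J z0) leNgt; apply/negP => Jz0.
have D0 : D !=set0 by exists z0.
have [z] := compact_EVT_max D0 cD (continuous_in_subspaceT cJ).
rewrite inE => Dz Jmax.
set K := J z; have K2 : 2 * B ^+ k < K by apply: lt_le_trans Jz0 (Jmax _ _); rewrite inE.
have K0 : 0 < K by apply: le_lt_trans K2; rewrite mulr_ge0 // exprn_ge0 // ltW.
have /andP[az0 az1] := aD z Dz; have /andP[bz0 bz1] := bD z Dz.
have az : 0 < a z.2.
  rewrite lt_neqAle az0 andbT; apply: contraTneq K0 => az'.
  by rewrite /K /J -az' mulr0 !mul0r ltxx.
have bz : 0 < b z.1.
  rewrite lt_neqAle bz0 andbT; apply: contraTneq K0 => bz'.
  by rewrite /K /J -bz' expr0n gtn_eqF ?(leq_trans _ k2) // mulr0 mul0r ltxx.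
have gz := g0 z Dz; have wz := w0 z Dz; have Qz := DQ z Dz.
have bkz : 0 < b z.1 ^+ k by rewrite exprn_gt0.
have qz : q z = K * (a z.2)^-1 * b z.1 ^- k * g z.
  by rewrite /K /J; field; rewrite !gt_eqF.
(* The maximum of [J] restated as contact: [q] stays below [K] times the singular barrier, with
   equality at [z] by [qz]. Positivity of [a] and [b] is an open condition, so the comparison holds
   in a full spatial neighbourhood and for all slightly earlier times. *)
have Jle y s : 0 < b y -> 0 < a s -> s <= t0 ->
    q (y, s) <= K * (a s)^-1 * b y ^- k * g (y, s).
  move=> by0 as0 st.
  have Dy : D (y, s).
    apply: DE; first exact: ltW.
    by move: as0; rewrite st andbT subr_gt0 ltr_pdivlMr // => h; lra.
  have := Jmax (y, s); rewrite inE => /(_ Dy); rewrite -/K {1}/J.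
  rewrite ler_pdivrMr ?g0 // /= => h.
  have -> : K * (a s)^-1 * b y ^- k * g (y, s) = K * g (y, s) / (a s * b y ^+ k).
    by field; rewrite expf_neq0 !gt_eqF.
  by rewrite ler_pdivlMr ?mulr_gt0 ?exprn_gt0 // mulrA.
clearbody K.
case: z => x s in Dz Jmax K K2 K0 az0 az1 bz0 bz1 az bz gz wz Qz bkz qz Jle *.
rewrite /= in az0 az1 bz0 bz1 az bz bkz qz.
have [Qs hN] := hd (x, s) Dz; rewrite /= in Qs hN.
set xs := d *: ev R i + x in Qs hN.
have st0 : s <= t0 by case: Dz => _ /andP[].
pose A := (w (x, s) / tau) `^ p^-1 / w (x, s).
pose g1 := r^-1 + A / p.
pose g2 := p^-1 * (1 - p^-1) * A / w (x, s).
pose K' := K * (a s)^-1 * b x ^- k.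
have K'0 : 0 < K' by rewrite !mulr_gt0 ?invr_gt0.
have A0 : 0 < A by rewrite divr_gt0 // powR_gt0 // divr_gt0.
have g10 : 0 < g1 by rewrite addr_gt0 ?invr_gt0 // divr_gt0.
pose N := gradnorm u x s.
have c0 : 0 < a s * b x ^+ k by rewrite mulr_gt0.
have K'E : K' = K / (a s * b x ^+ k) by rewrite /K' invfM mulrA.
have qK : q (x, s) = K' * g (x, s) by [].
have K'ge : 2 * (B ^+ k / (a s * b x ^+ k)) <= K'.
  by rewrite K'E mulrA ler_pM2r ?invr_gt0 // ltW.
have beta1 : 1 <= B ^+ k / (a s * b x ^+ k).
  rewrite ler_pdivlMr // mul1r; apply: (@le_trans _ _ 1); last exact: exprn_ege1.
  by rewrite mulr_ile1 // ?exprn_ile1 // exprn_ge0.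
(* The quotient differs from a partial derivative, up to sign, by at most half of [profile e0], and
   [e0 <= w] with a nondecreasing profile bounds this by [g/2]. *)
have Nq : q (x, s) <= N + g (x, s) / 2.
  apply: (@le_trans _ _ `|(u xs s - u x s) / d|).
    apply: le_trans (ler_norm _) _.
    by rewrite /q /= mulNr normrN !normrM !normfV normr_id.
  rewrite -(subrK (dx i u x s) ((u xs s - u x s) / d)).
  apply: le_trans (ler_normD _ _) _; rewrite addrC lerD ?dx_le_gradnorm //.
  apply: le_trans hN _; rewrite ler_pM2r ?invr_gt0 //.
  by apply: profile_le => //; exact: wD (x, s) Dz.
(* With [beta = B^k / (a b^k) >= 1], the bounds [2 beta g <= q <= N + g/2] give
   [N/g >= 2 beta - 1/2 >= beta]: the factor 2 in front of [B^k] pays for the quotient error. *)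
have NX : B ^+ k / (a s * b x ^+ k) <= N / g (x, s).
  by rewrite ler_pdivlMr //; rewrite qK in Nq; nra.
have N0 : 0 < N.
  by rewrite -(mulr0 0) -[N](divfK (lt0r_neq0 gz)) mulr0 mulr_gt0 // (lt_le_trans _ NX) // (lt_le_trans ltr01).
have D12 j : - (dx j u xs s - dx j u x s) / `|d| =
      K' * (4 * k%:R * x 0 j / (r ^+ 2 * b x) * g (x, s) - g1 * dx j u x s) /\
    - (dx j (dx j u) xs s - dx j (dx j u) x s) / `|d| <=
     K' * ((k%:R * k.+1%:R * 16 * x 0 j ^+ 2 / (r ^+ 4 * b x ^+ 2)
            + 4 * k%:R / (r ^+ 2 * b x)) * g (x, s)
          - 2 * (4 * k%:R * x 0 j / (r ^+ 2 * b x)) * g1 * dx j u x s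
          - g2 * dx j u x s ^+ 2 - g1 * dx j (dx j u) x s).
  have hb := has_d2_barrier n p r T tau m k u x s j r0 tau0 uC Qz wz bz.
  have hq1 := has_d2_line _ _ _ _ _ j r0 uC Qs.
  have hq2 := has_d2_line _ _ _ _ _ j r0 uC Qz.
  have hq := has_d2Z _ _ _ _ (- `|d|^-1) (has_d2D _ _ _ _ _ _ _ hq1 (has_d2Z _ _ _ _ (-1) hq2)).
  have hF := has_d2D _ _ _ _ _ _ _ hq (has_d2Z _ _ _ _ (- (K * (a s)^-1)) hb).
  have [|F1 F2] := has_d2_local_max _ _ _ _ hF.
    have cb : (fun t => b (t *: ev R j + x)) @ (0 : R) --> b x.
      have c1 := line_continuous x (ev R j) 0.
      rewrite /prop_for /continuous_at scale0r add0r in c1.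
      exact: (cvg_comp _ _ c1 (cutoff_continuous r x)).
    have nb : \forall t \near (0 : R), 0 < b (t *: ev R j + x).
      exact: (cvgr_gt _ cb).
    apply: filterS nb => t bt.
    rewrite !scale0r !add0r.
    have e1 : t *: ev R j + xs = d *: ev R i + (t *: ev R j + x).
      by rewrite /xs addrCA.
    rewrite e1.
    have h := Jle _ _ bt az st0.
    rewrite /q /= in h qz; rewrite -/xs in qz.
    have -> : - `|d|^-1 * (u xs s + -1 * u x s) + - (K / a s) *
        (cutoff r x ^- k * profile p r tau (m - u x s)) = 0.
      transitivity (- (u xs s - u x s) / `|d| - K / a s * b x ^- k * g (x, s)).
        by rewrite /b /g /w /=; ring.
      by rewrite qz subrr.
    apply: le_trans (_ : _ <= - (u (d *: ev R i + (t *: ev R j + x)) s - u (t *: ev R j + x) s) / `|d|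
       - K / a s * b (t *: ev R j + x) ^- k * g (t *: ev R j + x, s)) _.
      rewrite le_eqVlt; apply/orP; left; apply/eqP.
      by rewrite /b /g /w /=; ring.
    by rewrite subr_le0.
  have alg (P Q c e Z v : R) :
      - (P - Q) / v - c * e * Z = - v^-1 * (P + -1 * Q) + - c * (e * Z) by ring.
  split; last by rewrite -subr_le0 /K' alg; exact: F2.
  by apply/eqP; rewrite -subr_eq0 /K' alg; apply/eqP; exact: F1.
(* The maximum may occur at [s = t0], the top of [D], so the time derivative yields only an
   inequality, obtained from earlier times. *)
have Dt : K' * (- (2 / (t0 * a s)) * g (x, s) - g1 * dt u x s) <=
    - (dt u xs s - dt u x s) / `|d|.
  have [_ [_ [_ [_ [_ [tD _]]]]]] := uC.
  have h1 : is_derive s (1 : R) (u xs) (dt u xs s) := DeriveDef (tD _ Qs) erefl.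
  have h2 : is_derive s (1 : R) (u x) (dt u x s) := DeriveDef (tD _ Qz) erefl.
  have hw : is_derive s (1 : R) (fun y => m - u x y) (0 - dt u x s) :=
    is_deriveB (is_derive_cst m s (1 : R)) h2.
  have hp := @is_derive1_comp _ (profile p r tau) (fun y => m - u x y) s _ _
    (has_d2_is_derive _ _ _ _ (has_d2_profile p r tau (w (x, s)) tau0 wz)) hw.
  have ha : is_derive s (1 : R) a (2 / t0).
    have h := is_deriveB (is_deriveZ (2 / t0) (is_derive_id s (1 : R)))
      (is_derive_cst (1 : R) s (1 : R)).
    have -> : a = (fun y => 2 / t0 * y - 1) by apply/funext => y; rewrite /a mulrAC.
    by apply: (is_derive_eq h); rewrite /GRing.scale /= mulr1 subr0.
  have hai := is_deriveV (lt0r_neq0 az) ha.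
  have hF : is_derive s (1 : R) (fun y => - `|d|^-1 * (u xs y - u x y) +
      - (K * b x ^- k) * ((a y)^-1 * profile p r tau (m - u x y))) _ :=
    is_deriveD (is_deriveZ (- `|d|^-1) (is_deriveB h1 h2))
      (is_deriveZ (- (K * b x ^- k)) (is_deriveM hai hp)).
  have alg (P Q c v f y : R) :
      - (P - Q) / v - c / y * b x ^- k * f =
      - v^-1 * (P - Q) + - (c * b x ^- k) * (y^-1 * f) by ring.
  have F0 := is_derive_local_max_left _ _ _ hF.
  have {}F0 := F0 _.
  have alg2 (P Q c v e f f1 y : R) : y != 0 ->
      - (P - Q) * v - c / y * e * (- (2 / (t0 * y)) * f - f1 * Q) =
      - v * (P - Q) + - (c * e) *
        (y^-1 * (f1 * (0 - Q)) + f * (- y ^- 2 * (2 / t0))).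
    by move=> y0; field; rewrite y0 gt_eqF.
  rewrite -subr_ge0 /K' alg2 ?gt_eqF //; apply: F0.
  have ca : {for s, continuous a} := is_derive1_cts _ _ _ ha.
  have na : \forall y \near s, 0 < a y by exact: (cvgr_gt _ ca).
  apply: filterS na => y ay ys.
  have h := Jle _ _ bz ay (le_trans (ltW ys) st0).
  rewrite -!alg; apply: (@le_trans _ _ 0).
    by rewrite subr_le0; exact: h.
  by rewrite subr_ge0 le_eqVlt; apply/orP; left; apply/eqP; exact: esym qz.
have main := maximum_point_inequality n p K' `|d| r (b x) (a s) t0 (g (x, s)) g1 g2 k
  (fun j => x 0 j) (fun j => dx j u xs s) (fun j => dx j u x s)
  (fun j => dx j (dx j u) xs s) (fun j => dx j (dx j u) x s)
  (dt u xs s) (dt u x s) p1 K'0 d0 r0.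
have {}main := main _ N0 gz (ltW g10) (proj1 Dz) (pde _ _ Qs) (pde _ _ Qz)
  (fun j => proj1 (D12 j)) (fun j => proj2 (D12 j)) Dt.
rewrite bz bz1 -/(gradnorm u x s) -/N in main; have {}main := main isT.
have gap := barrier_gap p r tau (w (x, s)) A (a s) (b x) (N / g (x, s)) B
  (8 * k%:R * k.+1%:R + 4 * k%:R * n%:R) t0 k p1 r0 tau0 taur taut wz erefl.
rewrite az az1 bz bz1 in gap.
have gE : g (x, s) = w (x, s) * (r^-1 + A).
  by rewrite /g /profile /A; field; rewrite !gt_eqF.
have {}gap := gap isT isT k2 kp _ B1 hB1 hB2 NX _ _ gE erefl.
rewrite divfK ?gt_eqF // in gap.
have c00 : (0 : R) <= 8 * k%:R * k.+1%:R + 4 * k%:R * n%:R.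
  by rewrite addr_ge0 ?mulr_ge0.
have := le_lt_trans main (gap c00).
by rewrite -/g1 -/g2 ltxx.
Qed.

(** This settles the points with [u x t = M], where the shift [e0 = M - u x t] would fail to be
    positive. *)
Lemma gradient_zero_at_maximum {R : realType} n (r T M : R)
    (u : 'rV[R]_n -> R -> R) (x : 'rV[R]_n) (t : R) i :
  0 < r -> C21 (cyl r T) u -> (forall x t, cyl r T (x, t) -> u x t <= M) ->
  cyl r T (x, t) -> u x t = M -> dx i u x t = 0.
Proof.
move=> r0 uC uM Qz uE.
have [|//] := has_d2_local_max _ _ _ _ (has_d2_line _ _ _ _ _ i r0 uC Qz).
have c1 := line_continuous x (ev R i) 0.
rewrite /prop_for /continuous_at scale0r add0r in c1.
have lc : (fun y : R => (y *: ev R i + x, t)) @ (0 : R) --> (x, t).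
  exact: (cvg_pair c1 (cvg_cst t)).
have nc : \forall y \near (0 : R), cyl r T (y *: ev R i + x, t).
  have nQ := near_cyl r T (x, t) r0 Qz.
  exact: (lc _ nQ).
by apply: filterS nc => y Qy; rewrite scale0r add0r uE; exact: uM.
Qed.

(** A crude replacement of the square root of [n] by [n.+1], which keeps the constant positive in
    dimension 0. *)
Lemma gradnorm_le {R : realType} n (u : 'rV[R]_n -> R -> R) x t (L : R) :
  0 <= L -> (forall i, `|dx i u x t| <= L) -> gradnorm u x t <= n.+1%:R * L.
Proof.
move=> L0 hL.
rewrite -[leRHS]ger0_norm ?mulr_ge0 // -sqrtr_sqr; apply: ler_wsqrtr.
apply: (@le_trans _ _ (n%:R * L ^+ 2)).
  rewrite mulr_natl -[X in _ *+ X]card_ord -sumr_const; apply: ler_sum => i _.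
  by rewrite -real_normK ?num_real // lerXn2r ?nnegrE.
rewrite exprMn ler_wpM2r ?sqr_ge0 //.
by rewrite -natrX ler_nat (leq_trans (leqnSn n)) // -{1}[n.+1]expn1 leq_pexp2l.
Qed.

Theorem theorem2p8 (R : realType) (n : nat) (p : R) (hp : 1 < p) :
  exists C : R, 0 < C /\
  forall (Rr T : R) (u : 'rV[R]_n -> R -> R) (M : R),
    0 < Rr -> 0 < T ->
    C21 (cyl Rr T) u ->
    (forall x t, cyl Rr T (x, t) ->
       dt u x t - lap u x t = gradnorm u x t `^ p) ->
    (forall x t, cyl Rr T (x, t) -> u x t <= M) ->
    (forall e, 0 < e -> exists x t, cyl Rr T (x, t) /\ M - e < u x t) ->
    forall (x : 'rV[R]_n) (t : R), enorm x < Rr / 2 -> 0 < t < T ->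
      gradnorm u x t <=
        C * ((M - u x t) / Rr + ((M - u x t) / Num.min (Rr ^+ 2) t) `^ p^-1).
Proof.
have p0 : 0 < p := lt_trans ltr01 hp.
have pm : 0 < p - 1 by rewrite subr_gt0.
(* The cutoff exponent is chosen from [p] alone, by the Archimedean property; it must grow as [p]
   approaches 1. *)
have [k k2 kp] : exists2 k : nat, (2 <= k)%N & 1 <= k%:R * (p - 1).
  exists (Num.bound (p - 1)^-1).+2 => //.
  rewrite -ler_pdivrMr // mul1r; apply: (@le_trans _ _ (Num.bound (p - 1)^-1)%:R).
    by apply: ltW; apply: archi_boundP; rewrite invr_ge0 ltW.
  by rewrite ler_nat; do 2! apply: leqW.
pose S := (8 * k%:R * k.+1%:R + 4 * k%:R * n%:R + 2) * p + 4 * p * k%:R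
  + 16 * k%:R * p.
pose S' := 16 * k%:R * p ^+ 2.
have S0 : 0 <= S by rewrite !(addr_ge0, mulr_ge0) // ltW.
have S'0 : 0 <= S' by rewrite mulr_ge0 ?sqr_ge0 // mulr_ge0.
(* Chosen so that [B (p - 1)] exceeds both thresholds of [barrier_gap]; it depends on [n] and [p]
   only. *)
pose B := 1 + (S + S' + 1) / (p - 1).
have B1 : 1 <= B by rewrite lerDl divr_ge0 ?(ltW pm) // addr_ge0 // addr_ge0.
have BE : B * (p - 1) = (p - 1) + (S + S' + 1).
  by rewrite mulrDl mul1r divfK // gt_eqF.
have hB1 : S < B * (p - 1) by rewrite BE; lra.
have hB2 : S' < B * (p - 1) by rewrite BE; lra.
have B0 : 0 < B := lt_le_trans ltr01 B1.
(* [2 B^k] comes from the maximum principle, [2^k] from the cutoff being at least 1/2 at [x], and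
   the summand 1 absorbs the error [eps] of the difference quotient. *)
pose C1 := 2 * B ^+ k * 2 ^+ k + 1.
have C10 : 0 < C1 by rewrite addr_gt0 // !mulr_gt0 // exprn_gt0.
exists (n.+1%:R * (C1 * 2)); split; first by rewrite !mulr_gt0 // ltr0n.
move=> r T u M r0 T0 uC pde uM _ x t xr /andP[t0 tT].
set tau := Num.min (r ^+ 2) t.
have tau0 : 0 < tau by rewrite lt_min exprn_gt0.
have taur : tau <= r ^+ 2 by rewrite ge_min lexx.
have taut : tau <= t by rewrite ge_min lexx orbT.
have Qz : cyl r T (x, t).
  split => /=; last by rewrite t0.
  by apply: lt_trans xr _; rewrite ltr_pdivrMr // ltr_pMr ?ltr1n.
rewrite -/(profile p r tau (M - u x t)) -mulrA -mulrA.
have m0 : 0 <= M - u x t by rewrite subr_ge0; exact: uM.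
apply: gradnorm_le.
  by rewrite !mulr_ge0 ?(ltW C10) // addr_ge0 ?powR_ge0 // divr_ge0 // ltW.
move=> i.
have [uE|] := eqVneq (M - u x t) 0.
  have {}uE : u x t = M by apply/eqP; rewrite eq_sym -subr_eq0 uE.
  rewrite (gradient_zero_at_maximum _ _ _ _ _ _ _ i r0 uC uM Qz uE) normr0.
  by rewrite !mulr_ge0 ?(ltW C10) // addr_ge0 ?powR_ge0 // divr_ge0 // ltW.
set e0 := M - u x t => ne0.
have e00 : 0 < e0 by rewrite lt_neqAle eq_sym ne0.
pose D := [set z : 'rV[R]_n * R | normsq z.1 <= r ^+ 2 / 2 /\ t / 2 <= z.2 <= t].
have cD : compact D by exact: compact_closed_cylinder.
have DQ : D `<=` cyl r T.
  move=> z [h1 /andP[h2 h3]]; split.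
    rewrite enorm_lt //; apply: le_lt_trans h1 _.
    by rewrite ltr_pdivrMr // ltr_pMr ?ltr1n // exprn_gt0.
  by rewrite (lt_le_trans _ h2) ?divr_gt0 //= (le_lt_trans h3).
have xr2 : normsq x < r ^+ 2 / 4.
  by rewrite enorm_lt ?divr_gt0 // expr_div_n -natrX in xr.
have Dz : D (x, t).
  split => /=; last by rewrite lexx andbT ler_pdivrMr // ler_pMr // ler1n.
  by apply: le_trans (ltW xr2) _; rewrite ler_pM2l ?exprn_gt0 // lef_pV2 ?posrE // ler_nat.
pose eps := profile p r tau e0 / 2.
have eps0 : 0 < eps by rewrite divr_gt0 // profile_gt0.
have := uniform_difference_quotient r T eps u i D r0 eps0 uC cD DQ.
move=> [e /= e1 he].
(* The shift by [e0] keeps [w] away from 0 on the whole cylinder, where the power [1/p] is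
   smooth. *)
have uM' y s : cyl r T (y, s) -> e0 <= M + e0 - u y s.
  by move=> /uM h; rewrite -addrA addrCA lerDl subr_ge0.
(* Dividing by [|d|] lets the sign of [d] select the direction, so [d = e/2] and [d = - e/2] bound
   the partial derivative from below and from above. The comparison cylinder ends at time [t], where
   the time cutoff equals 1. *)
have key d : d != 0 -> `|d| < e ->
    - dx i u x t * Num.sg d <= 2 * B ^+ k * 2 ^+ k * profile p r tau (2 * e0) + eps.
  move=> dne de.
  have hd : forall z, D z -> cyl r T (d *: ev R i + z.1, z.2) /\
    `|(u (d *: ev R i + z.1) z.2 - u z.1 z.2) / d - dx i u z.1 z.2| <= eps.
    by apply: he => //=; rewrite sub0r normrN.
  have t0T : 0 < t < T by rewrite t0.
  have := difference_quotient_le n p B r T tau t (M + e0) e0 d k u i hp r0 t0T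
    tau0 taur taut e00 dne k2 kp B1 hB1 hB2 uC pde uM' hd (x, t) Dz.
  have [_ ] := hd _ Dz; rewrite /=.
  have -> : M + e0 - u x t = 2 * e0 by rewrite /e0; ring.
  set du := u _ t - u x t; set g := profile p r tau (2 * e0).
  have -> : 2 * t / t - 1 = 1 by field; rewrite gt_eqF.
  rewrite mulr1 => h1 h2.
  have b2 : 2^-1 <= cutoff r x.
    rewrite /cutoff lerBrDr -lerBrDl mulrAC ler_pdivrMr ?exprn_gt0 //.
    lra.
  have bk : 1 <= 2 ^+ k * cutoff r x ^+ k.
    by rewrite -exprMn exprn_ege1 // -ler_pdivrMl // mulr1.
  have g0 : 0 < g by rewrite profile_gt0 // mulr_gt0.
  have q1 : - du / `|d| <= 2 * B ^+ k * 2 ^+ k * g.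
    have [q0|q0] := leP (- du / `|d|) 0.
      by apply: le_trans q0 _; rewrite !mulr_ge0 ?exprn_ge0 ?(ltW B0) ?(ltW g0).
    apply: (@le_trans _ _ (- du / `|d| * (2 ^+ k * cutoff r x ^+ k))).
      by rewrite ler_peMr // ltW.
    have -> : - du / `|d| * (2 ^+ k * cutoff r x ^+ k) =
      2 ^+ k * (- du / `|d| * cutoff r x ^+ k) by ring.
    have -> : 2 * B ^+ k * 2 ^+ k * g = 2 ^+ k * (2 * B ^+ k * g) by ring.
    by rewrite ler_pM2l // exprn_gt0.
  have -> : - dx i u x t * Num.sg d = - du / `|d| + (du / d - dx i u x t) * Num.sg d.
    have -> : - du / `|d| = - (du / d) * Num.sg d.
      by rewrite {2}[d]numEsg; field; rewrite normr_eq0 sgr_eq0 dne.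
    ring.
  apply: lerD => //; apply: le_trans (ler_norm _) _.
  by rewrite normrM normr_sg dne mulr1.
have L1 : 2 * B ^+ k * 2 ^+ k * profile p r tau (2 * e0) + eps <=
    C1 * (2 * profile p r tau e0).
  have pd := profile_double p r tau e0 hp r0 tau0 (ltW e00).
  rewrite /C1 (mulrDl (2 * B ^+ k * 2 ^+ k)) mul1r; apply: lerD.
    by apply: ler_wpM2l => //; rewrite !mulr_ge0 ?exprn_ge0 // ltW.
  by rewrite /eps; have := profile_gt0 p r tau e0 r0 tau0 e00; lra.
have e2 : 0 < e / 2 by rewrite divr_gt0.
have ee : e / 2 < e by rewrite ltr_pdivrMr // ltr_pMr ?ltr1n.
apply: le_trans L1; rewrite ler_norml; apply/andP; split.
  rewrite lerNl; have := key (e / 2) (lt0r_neq0 e2).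
  by rewrite gtr0_norm // gtr0_sg // mulr1; apply.
have := key (- (e / 2)); rewrite oppr_eq0 normrN gtr0_norm // sgrN gtr0_sg //.
by rewrite mulrN1 opprK; apply => //; exact: lt0r_neq0.
Qed.
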